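(* For $u\in\mathbb{F}_{2^{12}}$, the mapping $$F':\mathbb{F}_{2^{12}}\to\mathbb{F}_{2^{12}},\qquad x\mapsto x^3+u\,x^{528}$$ is an APN mapping if and only if $$u\in\{x\in\mathbb{F}_{2^{12}} : \text{the multiplicative order of } x \text{ is divisible by } 45 \text{ and divides } 45\cdot 13\}\ \cup\ \{x\in\mathbb{F}_{2^{12}} : \text{the multiplicative order of } x \text{ is divisible by } 7 \text{ and divides } 3\cdot 7\cdot 13\}.$$
   Context: For a function $F:\mathbb{F}_{2^m}\to\mathbb{F}_{2^m}$ and $a,b\in\mathbb{F}_{2^m}$, let $\delta_F(a,b)$ be the number of $y\in\mathbb{F}_{2^m}$ with $F(y+a)+F(y)=b$. $F$ is called almost perfect nonlinear (APN) if $\max_{(a,b)\neq(0,0)}\delta_F(a,b)=2$ (equivalently, for every $a\neq 0$ and every $b$, the equation $F(y+a)+F(y)=b$ has at most $2$ solutions $y$).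
   Formalization: The formal theorem assumes u is nonzero: for u = 0 the map is x^3, which is APN on the field with 2^12 elements, while 0 has no multiplicative order and so lies in neither set, so the stated equivalence fails there. *)

(* Defs.v *)
From HB Require Import structures.
From mathcomp Require Import all_boot all_order all_algebra all_fingroup.
From mathcomp Require Import all_solvable all_field.

Set Implicit Arguments.
Unset Strict Implicit.
Unset Printing Implicit Defensive.

Import GRing.Theory FinRing.Theory.
Local Open Scope ring_scope.

Definition delta (K : finFieldType) (f : K -> K) (a b : K) : nat :=
  #|[set y : K | f (y + a) + f y == b]|.

(* Intended for K of characteristic 2, where f (y + a) + f y is the discrete
   derivative of f in direction a. *)
Definition APN (K : finFieldType) (f : K -> K) : Prop :=
  (\max_(ab : K * K | ab != (0%R, 0%R)) delta f ab.1 ab.2)%N = 2%N.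

(* Multiplicative orders are orders in the group {unit K}, so 0 has none and
   does not belong to this set. *)
Definition order_between (K : finFieldType) (d e : nat) : {set K} :=
  [set FinRing.uval v | v : {unit K} & (d %| #[v]%g)%N && (#[v]%g %| e)%N].

(* Main.v *)
(** The function is quadratic, so it is APN iff each additive map
    x |-> D_a(x) := F(x + a) + F(x) + F(a), a <> 0, has kernel {0, a}.
    Substituting x = a y, this says that
      y^2 + y = u a^525 (y^32 + y)^16
    has no solution y outside {0, 1}. Since gcd(525, 4095) = 105, only the
    discrete logarithm k of u modulo 105 matters. A discrete logarithm table
    for F_2[X]/(X^12 + X^6 + X^4 + X + 1) shows that the classes realised by
    some y are exactly those with gcd(105, k) different from 7 and 15, that is
    u^39 of order different from 15 and 7. The table also proves that X is
    primitive: it exhibits 1 + X^i as a power of X for 0 < i < 4095, so X^i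
    is not 1. It transfers to K because K contains a root of the modulus. *)
From Stdlib Require Import NArith FMapPositive.
Require Import Defs.
From HB Require Import structures.
From mathcomp Require Import all_boot all_order all_algebra all_fingroup.
From mathcomp Require Import all_solvable all_field.
From mathcomp Require Import zify ring.

Set Implicit Arguments.
Unset Strict Implicit.
Unset Printing Implicit Defensive.

Import GRing.Theory FinRing.Theory.
Local Open Scope ring_scope.

(** * Multiplicative orders and quadratic APN functions *)

Lemma expr1_neq0 (R : nzRingType) (n : nat) (x : R) :
  (0 < n)%N -> x ^+ n = 1 -> x != 0.
Proof.
move=> n0 xn; apply/eqP => x0; have /eqP := xn.
by rewrite x0 expr0n gtn_eqF // eq_sym oner_eq0.
Qed.

Lemma order_between_prim_root (K : finFieldType) (d e m : nat) (u : K) :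
  m.-primitive_root u ->
  (u \in order_between K d e) = (d %| m)%N && (m %| e)%N.
Proof.
move=> um; have u0 := expr1_neq0 (prim_order_gt0 um) (prim_expr_order um).
have om (v : {unit K}) : FinRing.uval v = u -> #[v]%g = m.
  move=> vu; apply/eqP; rewrite eqn_dvd order_dvdn (prim_order_dvd um).
  rewrite -val_eqE /= val_unitX /= vu (prim_expr_order um) eqxx /=.
  by rewrite -vu -val_unitX expg_order.
apply/imsetP/idP => [[v]|dme]; first by rewrite inE => + uv; rewrite (om v).
by exists (finField_unit u0); rewrite // inE om.
Qed.

(** Two solutions of [f (y + a) + f y = b] differ by a kernel element of the additive map in
    direction [a], so a nonempty fibre is a coset of that kernel, which always contains 0 and
    [a]. *)
Lemma APN_quadraticP (K : finFieldType) (f : K -> K) :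
  2%N \in [pchar K] -> f 0 = 0 ->
  (forall a, {morph (fun x => f (x + a) + f x + f a) : x y / x + y}) ->
  APN f <-> (forall a x, a != 0 -> f (x + a) + f x + f a = 0 -> x = 0 \/ x = a).
Proof.
move=> K2 f0 fD; have xx := addrr_pchar2 K2.
have eq_add (x y : K) : x + y = 0 -> x = y.
  by move=> xy; rewrite -[x]addr0 -(xx y) addrA xy add0r.
have sym a x y : f (y + a) + f y = f (x + a) + f x -> f (x + y + a) + f (x + y) + f a = 0.
  by move=> e; rewrite fD e xx.
split=> [APNf a x a0 fx|ker].
  have [->|/negPf x0] := eqVneq x 0; first by left.
  have [->|/negPf xa] := eqVneq x a; first by right.
  have : (2 < delta f a (f a))%N; last first.
    rewrite ltnNge -[X in (_ <= X)%N]APNf.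
    by rewrite (@bigmax_sup _ (a, f a)) // xpair_eqE negb_and a0.
  have -> : 3%N = #|[set 0; a; x]|.
    by rewrite setUC !cardsU1 !inE x0 xa cards1 eq_sym (negPf a0).
  apply: subset_leq_card.
  apply/subsetP => y; rewrite !inE => /orP[/orP[]|] /eqP->.
  - by rewrite add0r f0 addr0.
  - by rewrite xx f0 add0r.
  - by apply/eqP/eq_add.
apply/eqP; rewrite eqn_leq; apply/andP; split.
  apply/bigmax_leqP => -[a b] /=; rewrite xpair_eqE negb_and.
  have [-> /= b0|a0 _] := eqVneq a 0.
    rewrite /delta (_ : [set _ | _] = set0) ?cards0 //; apply/setP => y.
    by rewrite !inE addr0 xx eq_sym (negPf b0).
  rewrite /delta; have [->|[y]] := set_0Vmem [set y | f (y + a) + f y == b].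
    by rewrite cards0.
  rewrite inE => /eqP <-; apply: (@leq_trans #|[set y; y + a]|); last first.
    by rewrite cards2; case: (_ != _).
  apply/subset_leq_card/subsetP => x; rewrite !inE => /eqP /esym /sym.
  case/(ker _ _ a0) => [/eq_add->|<-]; first by rewrite eqxx.
  by rewrite (addrC x) addrA xx add0r eqxx orbT.
(* The value 2 is attained: in direction 1, both 0 and 1 are sent to [f 1]. *)
apply: (@bigmax_sup _ (1, f 1)); first by rewrite xpair_eqE oner_eq0.
rewrite /delta; apply: (@leq_trans #|[set 0; 1 : K]|).
  by rewrite cards2 eq_sym oner_eq0.
apply/subset_leq_card/subsetP => y; rewrite !inE => /orP[] /eqP->.
  by rewrite add0r f0 addr0.
by rewrite xx f0 add0r.
Qed.

(** * Arithmetic modulo the degree 12 polynomial *)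

(* A polynomial over F_2 is encoded by the number whose binary digits are its
   coefficients. *)
Fixpoint evalX_pos (R : nzRingType) (x : R) (p : positive) : R :=
  match p with
  | xH => 1
  | xO q => x * evalX_pos x q
  | xI q => 1 + x * evalX_pos x q
  end.

Definition evalX (R : nzRingType) (x : R) (n : N) : R :=
  if n is Npos p then evalX_pos x p else 0.

Lemma evalX_double (R : nzRingType) (x : R) n :
  evalX x (N.double n) = x * evalX x n.
Proof. by case: n => //=; rewrite mulr0. Qed.

Lemma evalX_lxor (R : nzRingType) (x : R) m n : 2%N \in [pchar R] ->
  evalX x (N.lxor m n) = evalX x m + evalX x n.
Proof.
move=> R2; have xx := addrr_pchar2 R2.
have dE k : evalX x (Pos.Ndouble k) = x * evalX x k by case: k => //=; rewrite mulr0.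
have sE k : evalX x (Pos.Nsucc_double k) = 1 + x * evalX x k.
  by case: k => //=; rewrite mulr0 addr0.
case: m n => [|p] [|q]; rewrite ?addr0 ?add0r //=.
elim: p q => [p IH|p IH|] [q|q|] //=; rewrite ?dE ?sE ?IH /= ?mulrDr //.
- by rewrite addrACA xx add0r.
- by rewrite addrA.
- by rewrite addrAC xx add0r.
- by rewrite addrCA.
- by rewrite addrC.
- by rewrite addrA xx add0r.
Qed.

(* Multiplication by X modulo X^12 + X^6 + X^4 + X + 1, encoded by 4179. *)
Definition mulX (n : N) : N :=
  if N.testbit n 11 then N.lxor (N.double n) 4179 else N.double n.

(** The multiple of the modulus is kept so that the lemma also applies to the indeterminate of a
    polynomial ring, where the modulus does not vanish. *)
Lemma exp_evalX (R : comNzRingType) (x : R) i : 2%N \in [pchar R] ->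
  exists c, x ^+ i = evalX x (iter i mulX 1%num) + c * evalX x 4179.
Proof.
move=> R2; elim: i => [|i [c IH]].
  by exists 0; rewrite mul0r addr0.
rewrite exprS IH iterS; move: (iter i _ _) => n; rewrite /mulX.
case: N.testbit; last first.
  by exists (x * c); rewrite evalX_double mulrDr mulrA.
exists (1 + x * c); rewrite evalX_lxor // evalX_double mulrDr mulrDl mul1r mulrA.
by rewrite -addrA [evalX x 4179 + _]addrA (addrr_pchar2 R2) add0r.
Qed.

Lemma exp_root_evalX (R : comNzRingType) (x : R) i :
  2%N \in [pchar R] -> evalX x 4179 = 0 -> x ^+ i = evalX x (iter i mulX 1%num).
Proof. by move=> R2 x0; have [c ->] := exp_evalX x i R2; rewrite x0 mulr0 addr0. Qed.

Lemma mulX_order : iter 4095 mulX 1%num = 1%num.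
Proof. by vm_compute. Qed.

Lemma horner_evalX (R : comNzRingType) (x : R) n :
  (evalX 'X n).[x] = evalX x n.
Proof.
case: n => [|p] /=; first by rewrite horner0.
by elim: p => [p IH|p IH|] /=; rewrite ?hornerE ?IH.
Qed.

(** The modulus divides X^4095 - 1, hence X^4096 - X, which splits over [K]. *)
Lemma root_evalX_exists (K : finFieldType) : #|K| = (2 ^ 12)%N ->
  exists x : K, evalX x 4179 = 0.
Proof.
move=> cardK; have K2 : 2%N \in [pchar K] by apply: (card_finPcharP cardK).
pose p : {poly K} := evalX 'X 4179.
have pdvd : p %| \prod_(a : K) ('X - a%:P).
  have [|c] := @exp_evalX {poly K} 'X 4095; first by rewrite pchar_poly.
  rewrite mulX_order -/p => X4095; rewrite -finField_genPoly cardK.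
  have -> : 'X^(2 ^ 12) - 'X = 'X * ('X^4095 - 1) :> {poly K}.
    by rewrite mulrBr mulr1 -exprS.
  by rewrite X4095 addrC addKr mulrA dvdp_mull.
have [m pm] := dvdp_prod_XsubC pdvd.
have : exists a, root p a.
  case: (mask m _) pm => [|a s] pm.
    (* An empty product would make [p] constant, but its coefficient of X^12 is 1. *)
    have : (size p <= 1)%N by rewrite (eqp_size pm) big_nil size_poly1.
    move=> /leq_sizeP /(_ 12 isT) /eqP.
    by rewrite /p /= !(coefD, coef1, coefXM, add0r, addr0, coefX) /= oner_eq0.
  exists a; rewrite (eqp_root pm) big_cons rootM root_XsubC eqxx //.
by case=> a /rootP pa; exists a; rewrite -horner_evalX.
Qed.

(** * The discrete logarithm table and the classes modulo 105 *)

(* The state is (i, X^i, X^(31 i)). *)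
Definition next_state (s : N * N * N) : N * N * N :=
  (N.succ s.1.1, mulX s.1.2, iter 31 mulX s.2).

Definition power_state (i : nat) : N * N * N := iter i next_state (0, 1, 1)%num.

Lemma power_stateE i :
  power_state i = (N.of_nat i, iter i mulX 1%num, iter (31 * i) mulX 1%num).
Proof.
elim: i => // i IH; rewrite /power_state iterS -/(power_state i) IH.
by rewrite mulnS iterD Nnat.Nat2N.inj_succ.
Qed.

(* Maps are indexed by positive numbers, so the key of n is n + 1. *)
Definition dlog_table : PositiveMap.t N :=
  foldr (fun s t => PositiveMap.add (N.succ_pos s.1.2) s.1.1 t)
    (PositiveMap.empty N)
    (traject next_state (0, 1, 1)%num 4095).

Definition dlog (n : N) : option N :=
  PositiveMap.find (N.succ_pos n) dlog_table.

Lemma dlogP (R : comNzRingType) (x : R) n j :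
  2%N \in [pchar R] -> evalX x 4179 = 0 ->
  dlog n = Some j -> x ^+ N.to_nat j = evalX x n.
Proof.
move=> R2 x0; rewrite /dlog /dlog_table.
have : {in traject next_state (0, 1, 1)%num 4095, forall s, x ^+ N.to_nat s.1.1 = evalX x s.1.2}.
  move=> s /trajectP[i _ ->]; rewrite -/(power_state i) power_stateE /=.
  by rewrite Nnat.Nat2N.id exp_root_evalX.
elim: traject => [_|s r IH rP] /=; first by rewrite PositiveMap.gempty.
have [e|ne] := Pos.eq_dec (N.succ_pos n) (N.succ_pos s.1.2).
  rewrite e PositiveMap.gss => -[<-]; rewrite rP ?mem_head //.
  by rewrite -(N.pos_pred_succ n) e N.pos_pred_succ.
rewrite PositiveMap.gso //; apply: IH => t tr; apply: rP.
by rewrite inE tr orbT.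
Qed.

(* For y = x^i, u = x^k and a = x^c, the equation
   y^2 + y = u a^525 (y^32 + y)^16 compares exponents modulo 4095, and is
   solvable in c iff k = log (y + 1) - 15 i - 16 log (y^31 + 1) mod 105. *)
Definition bad_log_of (s : N * N * N) : option N :=
  match dlog (N.lxor s.1.2 1), dlog (N.lxor s.2 1) with
  | Some a, Some b => Some (N.modulo (a + 90 * s.1.1 + 89 * b) 105)
  | _, _ => None
  end.

(** The exponents run from 1 to 4094: exponent 0 is y = 1, which solves the equation for every a. *)
Definition bad_logs : seq (option N) :=
  [seq bad_log_of s | s <-
    traject next_state (power_state 1) 4094].

Definition APN_log (k : nat) : bool := gcdn 105 k \in [:: 7; 15]%N.

(** Rejecting [None] makes the computation certify also that all the logarithms looked up exist,
    which primitivity relies on. *)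
Lemma bad_logs_not_APN :
  all (fun o => if o is Some r then ~~ APN_log (N.to_nat r) else false) bad_logs.
Proof. by vm_compute. Qed.

Lemma not_APN_bad_logs :
  all (fun k => APN_log k || (Some (N.of_nat k) \in bad_logs)) (iota 0 105).
Proof. by vm_compute. Qed.

(** Asking for some exponents [a] and [b] makes sense before [x] is known to be primitive. The
    constants 90 and 89 are -15 and -16 modulo 105. *)
Definition bad_log (R : comNzRingType) (x : R) (i k : nat) : Prop :=
  exists a b, [/\ x ^+ a = x ^+ i + 1, x ^+ b = (x ^+ i) ^+ 31 + 1
    & (a + 90 * i + 89 * b = k %[mod 105])%N].

Lemma bad_log_ofP (R : comNzRingType) (x : R) i r :
  2%N \in [pchar R] -> evalX x 4179 = 0 ->
  bad_log_of (power_state i) = Some r -> bad_log x i (N.to_nat r).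
Proof.
move=> R2 x0; rewrite power_stateE /bad_log_of /=.
case ea: dlog => [a|//]; case eb: dlog => [b|//] [<-].
exists (N.to_nat a), (N.to_nat b); split.
- by rewrite (dlogP R2 x0 ea) evalX_lxor // -exp_root_evalX.
- by rewrite (dlogP R2 x0 eb) evalX_lxor // -exp_root_evalX // mulnC exprM.
have /(congr1 N.to_nat) := N.Div0.div_mod (a + 90 * N.of_nat i + 89 * b) 105.
move: (N.modulo _ _) (N.div _ _) => m q; lia.
Qed.

Lemma mem_bad_logs o :
  reflect (exists2 i, (0 < i < 4095)%N & o = bad_log_of (power_state i))
    (o \in bad_logs).
Proof.
apply: (iffP mapP) => [[s /trajectP[i lti ->] ->]|[i /andP[i0 lti] ->]].
  exists i.+1; first exact: lti.
  by rewrite /power_state [in RHS]iterSr.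
exists (power_state i); last exact: erefl.
apply/trajectP; exists i.-1; first by rewrite -ltnS prednK.
by rewrite /power_state -iterD addn1 prednK.
Qed.

Lemma bad_log_exists (R : comNzRingType) (x : R) i :
  2%N \in [pchar R] -> evalX x 4179 = 0 -> (0 < i < 4095)%N ->
  exists2 k, ~~ APN_log k & bad_log x i k.
Proof.
move=> R2 x0 lti.
have /(allP bad_logs_not_APN) : bad_log_of (power_state i) \in bad_logs.
  by apply/mem_bad_logs; exists i.
case e: bad_log_of => [r|] // rN; exists (N.to_nat r) => //.
exact: bad_log_ofP.
Qed.

Lemma not_APN_log (R : comNzRingType) (x : R) k :
  2%N \in [pchar R] -> evalX x 4179 = 0 -> ~~ APN_log k ->
  exists2 i, (0 < i < 4095)%N & bad_log x i k.
Proof.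
move=> R2 x0 kN; have k105 : (k %% 105 \in iota 0 105)%N by rewrite mem_iota ltn_mod.
have := allP not_APN_bad_logs _ k105.
have -> : APN_log (k %% 105) = APN_log k by rewrite /APN_log gcdn_modr.
rewrite (negPf kN) orFb => /mem_bad_logs[i lti /esym e].
exists i => //; have [a [b [? ? ek]]] := bad_log_ofP R2 x0 e.
by exists a, b; split; rewrite // ek Nnat.Nat2N.id modn_mod.
Qed.

Lemma prim_root_evalX (K : fieldType) (x : K) :
  2%N \in [pchar K] -> evalX x 4179 = 0 -> 4095.-primitive_root x.
Proof.
move=> K2 x0; have x1 : x ^+ 4095 = 1 by rewrite (exp_root_evalX 4095 K2 x0) mulX_order.
have nz : x != 0 by apply: expr1_neq0 x1.
apply/andP; split=> //; apply/forallP => i; rewrite unity_rootE.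
have := ltn_ord i; rewrite leq_eqVlt => /orP[/eqP->|lti]; first by rewrite x1 !eqxx.
rewrite (ltn_eqF lti) eqbF_neg; have [|k _ [a [b [xa _ _]]]] := @bad_log_exists _ x i.+1 K2 x0 => //.
apply/eqP => e; have /eqP := xa; rewrite e addrr_pchar2 // expf_eq0 (negPf nz) andbF //.
Qed.

(** * The kernel equation in terms of logarithms *)

Lemma finField_prim_root_exp (K : finFieldType) (x y : K) :
  #|K|.-1.-primitive_root x -> y != 0 -> exists2 i, (i < #|K|.-1)%N & y = x ^+ i.
Proof.
move=> xp y0; have y1 : y ^+ #|K|.-1 = 1.
  apply: (mulfI y0); rewrite mulr1 -exprS prednK ?expf_card //.
  exact: ltnW (finNzRing_gt1 K).
by have [i ->] := prim_rootP xp y1; exists i.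
Qed.

Lemma kernel_trivial_APN_log (K : finFieldType) (x a y : K) k :
  #|K| = (2 ^ 12)%N -> evalX x 4179 = 0 -> APN_log k -> a != 0 ->
  y ^+ 2 + y = x ^+ k * a ^+ 525 * (y ^+ 32 + y) ^+ 16 -> y = 0 \/ y = 1.
Proof.
move=> cardK x0 kP a0 eqy; have K2 : 2%N \in [pchar K] by apply: (card_finPcharP cardK).
have xp := prim_root_evalX K2 x0.
have powP z : z != 0 -> exists2 i, (i < 4095)%N & z = x ^+ i.
  by have := @finField_prim_root_exp K x z; rewrite cardK; apply.
have [->|y0] := eqVneq y 0; first by left.
have [c _ ac] := powP a a0; have [i lti yi] := powP y y0.
case: (posnP i) => [i0|i0]; first by right; rewrite yi i0.
have [|r rN [A [B [xA xB ABr]]]] := @bad_log_exists _ x i K2 x0; first by rewrite i0.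
case/negP: rN; move: kP; rewrite /APN_log -[gcdn 105 k]gcdn_modr -[gcdn 105 r]gcdn_modr -ABr.
suff -> : (k = A + 90 * i + 89 * B %[mod 105])%N by [].
(* Both sides of the equation are written as powers of [x]. Modulo 105 the term in [c] disappears,
   since 105 divides 525. *)
have : x ^+ (i + A) = x ^+ (k + c * 525 + (i + B) * 16).
  rewrite !(exprD, exprM) xA xB -yi -ac mulrDr mulr1 -expr2 eqy.
  by rewrite mulrDr mulr1 -exprS.
move/eqP; rewrite (eq_prim_root_expr xp) => /eqP /(congr1 (modn^~ 105)).
rewrite !modn_dvdm // => e.
(* Adding 89 (i + B) to both sides cancels 16 (i + B) modulo 105. *)
rewrite -(modnMDl (5 * c + i + B) k).
have -> : ((5 * c + i + B) * 105 + k = k + c * 525 + (i + B) * 16 + 89 * (i + B))%N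
  by clear; lia.
have -> : (A + 90 * i + 89 * B = i + A + 89 * (i + B))%N
  by clear; lia.
by rewrite -[LHS]modnDml -e modnDml.
Qed.

Lemma kernel_nontrivial_log (K : finFieldType) (x : K) k :
  #|K| = (2 ^ 12)%N -> evalX x 4179 = 0 -> ~~ APN_log k ->
  exists a y, [/\ a != 0, y != 0, y != 1 &
    y ^+ 2 + y = x ^+ k * a ^+ 525 * (y ^+ 32 + y) ^+ 16].
Proof.
move=> cardK x0 kN; have K2 : 2%N \in [pchar K] by apply: (card_finPcharP cardK).
have xp := prim_root_evalX K2 x0.
have xn0 n : x ^+ n != 0 by rewrite expf_neq0 // (expr1_neq0 _ (prim_expr_order xp)).
have [i /andP[i0 lti] [A [B [xA xB ABk]]]] := not_APN_log K2 x0 kN.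
(* [D] is the logarithm required of a^525; the factor 4094 acts as -1 modulo 4095. *)
set D := (i + A + 4094 * (k + 16 * (i + B)))%N.
have /dvdnP[m Dm] : (105 %| D)%N.
  have -> : (D = 105 * (623 * i + 623 * B + 38 * k) + (A + 90 * i + 89 * B + 104 * k))%N.
    by rewrite /D; clear; lia.
  rewrite dvdn_addr ?dvdn_mulr // /dvdn -modnDml ABk modnDml.
  by rewrite -{1}[k]mul1n -mulnDl modnMr.
(* a^525 = x^D because 525 * 8 = 105 mod 4095. *)
exists (x ^+ (8 * m)), (x ^+ i); split=> //.
  by rewrite -(expr0 x) (eq_prim_root_expr xp) mod0n modn_small // -lt0n.
have -> : (x ^+ i) ^+ 2 + x ^+ i = x ^+ (i + A).
  by rewrite exprD xA mulrDr mulr1.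
have -> : (x ^+ i) ^+ 32 + x ^+ i = x ^+ (i + B).
  by rewrite exprD xB mulrDr mulr1 -exprS.
rewrite -!exprM -!exprD; apply/eqP; rewrite (eq_prim_root_expr xp).
have -> : (k + 8 * m * 525 + (i + B) * 16
    = (m + (k + 16 * (i + B))) * 4095 + (i + A))%N.
  by move: Dm; rewrite /D; clear; lia.
by rewrite modnMDl.
Qed.

(** * Polarization of the binomial *)

Lemma exprD_pow2 (K : comNzRingType) e (x y : K) : 2%N \in [pchar K] ->
  (x + y) ^+ (2 ^ e) = x ^+ (2 ^ e) + y ^+ (2 ^ e).
Proof.
by move=> K2; rewrite exprDn_pchar // (eq_pnat _ (pcharf_eq K2)) pnatX pnat_id.
Qed.

(** Since 3 = 2 + 1 and 528 = 2^9 + 2^4, each monomial is a product of two Frobenius powers, hence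
    quadratic. *)
Lemma binomial_polarization (K : comNzRingType) (u a x : K) :
  2%N \in [pchar K] ->
  ((x + a) ^+ 3 + u * (x + a) ^+ 528) + (x ^+ 3 + u * x ^+ 528)
    + (a ^+ 3 + u * a ^+ 528)
  = x ^+ 2 * a + x * a ^+ 2 + u * (x ^+ 512 * a ^+ 16 + x ^+ 16 * a ^+ 512).
Proof.
move=> K2; have two0 : 2%:R = 0 :> K by apply: pcharf0.
have e528 (z : K) : z ^+ 528 = z ^+ (2 ^ 9) * z ^+ (2 ^ 4) by rewrite -exprD.
rewrite !e528 !exprD_pow2 //.
rewrite -[512%N]/(2 ^ 9)%N -[16%N]/(2 ^ 4)%N.
move: (x ^+ (2 ^ 9)) (x ^+ (2 ^ 4)) (a ^+ (2 ^ 9)) (a ^+ (2 ^ 4)) => X9 X4 A9 A4.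
(* [ring] does not know that 2 = 0, so the surplus of the expansion is added on the right as a
   multiple of 2. *)
rewrite -[RHS]addr0 -[in RHS](mul0r (x ^+ 3 + a ^+ 3 + x ^+ 2 * a + x * a ^+ 2 + u * (X9 * X4 + A9 * A4))) -two0.
by ring.
Qed.

Lemma binomial_APN_iff_kernel (K : finFieldType) (u : K) :
  2%N \in [pchar K] ->
  APN (fun x : K => x ^+ 3 + u * x ^+ 528) <->
  forall a y, a != 0 -> y ^+ 2 + y = u * a ^+ 525 * (y ^+ 32 + y) ^+ 16 ->
    y = 0 \/ y = 1.
Proof.
move=> K2.
have polE a y : (a * y) ^+ 2 * a + (a * y) * a ^+ 2
    + u * ((a * y) ^+ 512 * a ^+ 16 + (a * y) ^+ 16 * a ^+ 512)
    = a ^+ 3 * ((y ^+ 2 + y) + u * a ^+ 525 * (y ^+ 32 + y) ^+ 16).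
  have -> : (y ^+ 32 + y) ^+ 16 = y ^+ 512 + y ^+ 16.
    by rewrite (@exprD_pow2 K 4) // -exprM.
  rewrite !exprMn.
  (* The exponents are split as 512 = 496 + 16 and 16 = 3 + 13 to expose the factor a^3 while hiding
     large powers from [ring]. *)
  have -> : a ^+ 512 = a ^+ 496 * a ^+ 16 by rewrite -exprD.
  have -> : a ^+ 525 = a ^+ 496 * (a ^+ 13 * a ^+ 16) by rewrite -!exprD.
  have -> : a ^+ 16 = a ^+ 3 * a ^+ 13 by rewrite -exprD.
  move: (a ^+ 496) (a ^+ 13) (y ^+ 512) (y ^+ 16) => ? ? ? ?; ring.
have eq_add (z t : K) : z + t = 0 <-> z = t.
  by rewrite -{1}(oppr_pchar2 K2 t); split=> [/subr0_eq|->]; rewrite ?subrr.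
rewrite APN_quadraticP // => [|/=|a z t /=]; last 2 first.
- by rewrite !expr0n /= mulr0 addr0.
- rewrite !binomial_polarization // -[512%N]/(2 ^ 9)%N -[16%N]/(2 ^ 4)%N.
  rewrite !exprD_pow2 // -[2%N]/(2 ^ 1)%N exprD_pow2 //.
  move: (z ^+ (2 ^ 9)) (z ^+ (2 ^ 4)) (t ^+ (2 ^ 9)) (t ^+ (2 ^ 4)) => ? ? ? ?.
  by ring.
split=> ker a z a0.
  move=> /eq_add eqz; have := ker a (a * z) a0.
  rewrite binomial_polarization // polE eqz mulr0 => /(_ erefl)[/eqP|/eqP].
    by rewrite mulf_eq0 (negPf a0) => /eqP; left.
  by rewrite -{2}[a]mulr1 (inj_eq (mulfI a0)) => /eqP; right.
have [t ->] : exists t, z = a * t by exists (z / a); rewrite mulrC divfK.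
rewrite binomial_polarization // polE => /eqP.
rewrite mulf_eq0 expf_eq0 (negPf a0) /= => /eqP/eq_add /(ker _ _ a0)[->|->].
  by left; rewrite mulr0.
by right; rewrite mulr1.
Qed.

(** * From logarithms to orders *)

(** Here [m] is the order of the [k]-th power of a primitive element. As 105 divides 4095, both
    sides depend only on gcd(k, 4095), which leaves a check over the divisors of 4095. *)
Lemma APN_log_order k m : m = (4095 %/ gcdn k 4095)%N ->
  APN_log k =
    ((45 %| m) && (m %| 45 * 13) || (7 %| m) && (m %| 3 * 7 * 13))%N.
Proof.
move=> ->; have -> : APN_log k = APN_log (gcdn k 4095).
  have /gcdn_idPl dvd105 : (105 %| 4095)%N by [].
  by rewrite /APN_log [gcdn k _]gcdnC gcdnA dvd105.
have : gcdn k 4095 \in divisors 4095 by rewrite -dvdn_divisors ?dvdn_gcdr.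
pose order_cond m :=
  ((45 %| m) && (m %| 45 * 13) || (7 %| m) && (m %| 3 * 7 * 13))%N.
have /allP div_ok :
  all (fun d => APN_log d == order_cond (4095 %/ d)%N) (divisors 4095).
  by vm_compute.
by move/div_ok/eqP.
Qed.

Theorem theorem2 (K : finFieldType) (hK : #|K| = (2 ^ 12)%N)
    (u : K) (hu : u != 0) :
  APN (fun x : K => x ^+ 3 + u * x ^+ 528) <->
  u \in order_between K 45 (45 * 13) :|: order_between K 7 (3 * 7 * 13).
Proof.
have K2 : 2%N \in [pchar K] by apply: (card_finPcharP hK).
have [x x0] := root_evalX_exists hK; have xp := prim_root_evalX K2 x0.
have [k _ uk] : exists2 k, (k < 4095)%N & u = x ^+ k.
  by have := @finField_prim_root_exp K x u; rewrite hK; apply.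
have up := exp_prim_root xp k; rewrite -uk in up.
rewrite inE !(order_between_prim_root _ _ up) -(APN_log_order (erefl _)) binomial_APN_iff_kernel // uk.
split=> [ker|kP a y a0]; last exact: kernel_trivial_APN_log.
apply/negPn/negP => /(kernel_nontrivial_log hK x0)[a [y [a0 /eqP y0 /eqP y1]]].
by case/(ker _ _ a0).
Qed.
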